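(* Let $\mathcal{A}$ be an associative unital algebra over an arbitrary field $\mathbb{F}$, let $a,b\in\mathcal{A}$ be Drazin invertible, and suppose $ab=\lambda ba$ for some $\lambda\in\mathbb{F}$ with $\lambda\neq 0$. Then $a-b$ is Drazin invertible if and only if $w=aa^{D}(a-b)bb^{D}$ is Drazin invertible. In this case (with the inverses appearing in the formula existing in $\mathcal{A}$), $$(a-b)^{D}=w^{D}+a^{D}(1-bb^{\pi}a^{D})^{-1}b^{\pi}-a^{\pi}(1-b^{D}aa^{\pi})^{-1}b^{D}.$$
   Context: An element $a$ of an associative unital ring or algebra is Drazin invertible if there is an element $x$ (unique if it exists, denoted $a^{D}$) such that $xax=x$, $ax=xa$, and $a^{k}=a^{k+1}x$ for some nonnegative integer $k$ (equivalently, $xax=x$, $ax=xa$ and $a-a^{2}x$ is nilpotent). For Drazin invertible $a$, write $a^{\pi}=1-aa^{D}$, which is an idempotent. *)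

(* Defs.v *)
From HB Require Import structures.
From mathcomp Require Import all_boot all_order all_algebra.
Set Implicit Arguments.
Unset Strict Implicit.
Unset Printing Implicit Defensive.
Import GRing.Theory.
Local Open Scope ring_scope.

(* MathComp's algType requires 1 != 0; pzAlgType does not, so that it contains
   the zero algebra.  Every algType is an instance, with alg_scale = *:%R.
   The scaling is not the *: of lmodType: Hierarchy-Builder rejects a join of
   PzRing and Lmodule declared after GRing.Lalgebra. *)
HB.mixin Record PzRing_isPzAlgebra (R : pzRingType) A of GRing.PzRing A := {
  alg_scale : R -> A -> A;
  alg_scaleA : forall (k l : R) (x : A),
    alg_scale k (alg_scale l x) = alg_scale (k * l) x;
  alg_scale1 : forall x : A, alg_scale 1 x = x;
  alg_scaleDr : forall (k : R) (x y : A),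
    alg_scale k (x + y) = alg_scale k x + alg_scale k y;
  alg_scaleDl : forall (k l : R) (x : A),
    alg_scale (k + l) x = alg_scale k x + alg_scale l x;
  alg_scaleAl : forall (k : R) (x y : A),
    alg_scale k (x * y) = alg_scale k x * y;
  alg_scaleAr : forall (k : R) (x y : A),
    alg_scale k (x * y) = x * alg_scale k y
}.

#[short(type="pzAlgType")]
HB.structure Definition PzAlgebra (R : pzRingType) :=
  {A of GRing.PzRing A & PzRing_isPzAlgebra R A}.

#[non_forgetful_inheritance]
HB.instance Definition _ (R : pzRingType) (A : algType R) :=
  PzRing_isPzAlgebra.Build R (GRing.Algebra.sort A)
    (@scalerA R A) (@scale1r R A) (@scalerDr R A)
    (fun k l x => scalerDl x k l) (@scalerAl R A) (@scalerAr R A).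

Section Drazin.
Variable A : pzRingType.
Implicit Types a x y z : A.

Definition is_drazin_inverse a x : Prop :=
  [/\ x * a * x = x, a * x = x * a & exists k : nat, a ^+ k = a ^+ k.+1 * x].

Definition drazin_invertible a : Prop := exists x, is_drazin_inverse a x.

(* [spectral_idem a x] is $a^{\pi}$ when x is the Drazin inverse of a. *)
Definition spectral_idem a x : A := 1 - a * x.

(* A need not be a unitRingType, so x^-1 is not available. *)
Definition is_inverse x y : Prop := x * y = 1 /\ y * x = 1.

Lemma is_inverse_uniq x y z : is_inverse x y -> is_inverse x z -> y = z.
Proof. by move=> [_ yx] [xz _]; rewrite -[y]mulr1 -xz mulrA yx mul1r. Qed.

Lemma is_drazin_inverse_uniq a x y :
  is_drazin_inverse a x -> is_drazin_inverse a y -> x = y.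
Proof.
have pow z n : is_drazin_inverse a z -> z = z ^+ n.+1 * a ^+ n.
  case=> zaz az _; elim: n => [|n IHn]; first by rewrite mulr1.
  by rewrite exprS (exprSr a) -mulrA (mulrA (z ^+ _)) -IHn -az mulrA zaz.
have stab z k m : a ^+ k = a ^+ k.+1 * z -> (k <= m)%N ->
    a ^+ m = a ^+ m.+1 * z.
  by move=> h /subnK <-; rewrite -addnS !exprD {1}h !mulrA.
move=> hx hy; case: (hx) (hy) => _ ax [k hk] [_ ay [l hl]].
pose m := maxn k l.
have hxx := stab _ _ m hk (leq_maxl k l).
have hxy := stab _ _ m hl (leq_maxr k l).
have comX z n : is_drazin_inverse a z ->
    a ^+ n * z ^+ n.+1 = z ^+ n.+1 * a ^+ n.
  by case=> _ az _; apply: commrX; apply/commr_sym/commrX/commr_sym.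
have -> : x = x * a * y.
  by rewrite {1}(pow x m hx) hxy (exprSr a) !mulrA -(pow x m hx).
rewrite [RHS](pow y m hy) -(comX y m hy) hxx -(commrX m.+1 (commr_sym ax)).
by rewrite (exprS a) -!mulrA (comX y m hy) -(pow y m hy).
Qed.

End Drazin.

(* Main.v *)
(* The idempotents $p = aa^D$ and $q = bb^D$ commute with a, b and with each
   other, so a - b is the orthogonal sum of its four compressions.  The one to
   pq is w.  On p(1-q), a is invertible and b is nilpotent, and since they
   commute up to a scalar, a - b is invertible there; symmetrically on (1-p)q.
   On (1-p)(1-q) both are nilpotent, hence so is a - b. *)
Require Import Defs.
From mathcomp Require Import all_boot all_order all_algebra.
Import GRing.Theory.
Local Open Scope ring_scope.

(** * Drazin inverses in a ring: spectral idempotents, orthogonal sums, corners *)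

Section RingDrazin.
Set Implicit Arguments.
Unset Strict Implicit.
Variable A : pzRingType.
Implicit Types a b c d e f t u x y z : A.

Lemma is_inverse_comm {x y e} :
  is_inverse x y -> GRing.comm e x -> GRing.comm e y.
Proof.
move=> [xy yx] ex; rewrite /GRing.comm.
by rewrite -[LHS]mul1r -yx -mulrA (mulrA x) -ex -(mulrA e) xy mulr1.
Qed.

(** The inverse is the geometric series of [x], which stops at [n]. *)
Lemma is_inverse_1B_nilp {x n} : x ^+ n = 0 -> exists y, is_inverse (1 - x) y.
Proof.
move=> xn0; have h : (1 - x) * \sum_(i < n) x ^+ i = 1.
  by rewrite -opprB mulNr -subrX1 opprB xn0 subr0.
exists (\sum_(i < n) x ^+ i); split=> //; rewrite -[RHS]h.
have xS : GRing.comm x (\sum_(i < n) x ^+ i).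
  by apply: commr_sum => i _; exact: commrX (commr_refl x).
by rewrite mulrBl mulrBr mulr1 mul1r xS.
Qed.

Lemma idem_expS {e} n : e * e = e -> e ^+ n.+1 = e.
Proof. by move=> ee; elim: n => // n IHn; rewrite exprS IHn. Qed.

Lemma exp_stable {a x k m} :
  a ^+ k = a ^+ k.+1 * x -> (k <= m)%N -> a ^+ m = a ^+ m.+1 * x.
Proof. by move=> h /subnK <-; rewrite -addnS !exprD {1}h !mulrA. Qed.

Lemma drazin_comm {a x} : is_drazin_inverse a x -> GRing.comm a x.
Proof. by case. Qed.

Lemma drazin_comm_idem {a x} : is_drazin_inverse a x -> GRing.comm a (a * x).
Proof. by move=> h; apply: commrM => //; apply: drazin_comm. Qed.

Lemma drazin_mull {a x} : is_drazin_inverse a x -> a * x * x = x.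
Proof. by case=> xax ax _; rewrite ax. Qed.

Lemma drazin_mulr {a x} : is_drazin_inverse a x -> x * (a * x) = x.
Proof. by case=> xax _ _; rewrite mulrA. Qed.

Lemma drazin_idem {a x} : is_drazin_inverse a x -> a * x * (a * x) = a * x.
Proof. by move=> h; rewrite -mulrA (drazin_mulr h). Qed.

(** Lets the idempotent supply a power of [a] high enough to annihilate [spectral_idem a x]. *)
Lemma drazin_idemX {a x} n :
  is_drazin_inverse a x -> a * x = a ^+ n.+1 * x ^+ n.+1.
Proof.
move=> h; elim: n => // n IHn.
by rewrite (exprS a) (exprSr x) -!mulrA (mulrA (a ^+ _)) -IHn (drazin_mull h).
Qed.

Lemma spectral_idem_idem {a x} : is_drazin_inverse a x ->
  spectral_idem a x * spectral_idem a x = spectral_idem a x.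
Proof.
move=> h; rewrite /spectral_idem mulrBl mul1r mulrBr mulr1 (drazin_idem h).
by rewrite subrr subr0.
Qed.

Lemma mul_spectral_idem {a x} : is_drazin_inverse a x ->
  x * spectral_idem a x = 0.
Proof. by move=> h; rewrite mulrBr mulr1 (drazin_mulr h) subrr. Qed.

Lemma idem_spectral_idem {a x} : is_drazin_inverse a x ->
  a * x * spectral_idem a x = 0.
Proof. by move=> h; rewrite -mulrA (mul_spectral_idem h) mulr0. Qed.

Lemma spectral_idem_idem0 {a x} : is_drazin_inverse a x ->
  spectral_idem a x * (a * x) = 0.
Proof. by move=> h; rewrite mulrBl mul1r (drazin_idem h) subrr. Qed.

Lemma comm_spectral_idem {e a x} :
  GRing.comm e (a * x) -> GRing.comm e (spectral_idem a x).
Proof. by move=> h; apply: commrB => //; apply: commr1. Qed.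

Lemma drazin_nilp {a x} : is_drazin_inverse a x ->
  exists n, a ^+ n.+1 * spectral_idem a x = 0.
Proof.
case=> _ _ [k hk]; exists k.
by rewrite mulrBr mulr1 mulrA -exprSr -(exp_stable hk (leqnSn k)) subrr.
Qed.

Lemma nilp_is_drazin {a n} : a ^+ n = 0 -> is_drazin_inverse a 0.
Proof. by move=> an0; split; rewrite ?mulr0 ?mul0r //; exists n; rewrite mulr0. Qed.

(** An inverse in a corner with unit [e] is a Drazin inverse in the whole ring:
    [d * c * d = e * d = d], and [c = c * e = c ^+ 2 * d] gives exponent 1. *)
Lemma corner_is_drazin {c d e} :
  c * d = e -> d * c = e -> c * e = c -> e * d = d -> is_drazin_inverse c d.
Proof.
move=> cd dc ce ed; split; rewrite ?dc //; exists 1%N.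
by rewrite expr1 expr2 -mulrA cd.
Qed.

(** Orthogonality passes to the inverses, since [x] has a factor [a] on either side and [y] a factor
    [b]; all mixed products then vanish. *)
Lemma is_drazin_inverseD {a b x y} :
    is_drazin_inverse a x -> is_drazin_inverse b y -> a * b = 0 -> b * a = 0 ->
  is_drazin_inverse (a + b) (x + y).
Proof.
move=> hx hy ab ba.
have bx : b * x = 0 by rewrite -(drazin_mull hx) !mulrA ba !mul0r.
have ay : a * y = 0 by rewrite -(drazin_mull hy) !mulrA ab !mul0r.
have xb : x * b = 0 by rewrite -(drazin_mulr hx) (drazin_comm hx) -!mulrA ab !mulr0.
have ya : y * a = 0 by rewrite -(drazin_mulr hy) (drazin_comm hy) -!mulrA ba !mulr0.
have powD n : (a + b) ^+ n.+1 = a ^+ n.+1 + b ^+ n.+1.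
  elim: n => // n IHn; rewrite exprS IHn mulrDl !mulrDr -!exprS.
  by rewrite !(exprS _ n) !mulrA ab ba !mul0r addr0 add0r.
case: (hx) (hy) => xax ax [k hk] [yby by_ [l hl]]; split.
- have -> : (x + y) * (a + b) = x * a + y * b.
    by rewrite mulrDl !mulrDr xb ya addr0 add0r.
  rewrite mulrDl !mulrDr xax yby -[x * a * y]mulrA -[y * b * x]mulrA ay bx.
  by rewrite !mulr0 addr0 add0r.
- by rewrite !mulrDl !mulrDr bx ay xb ya ax by_.
(* The successor is needed because [powD] fails for exponent 0. *)
exists (maxn k l).+1; rewrite !powD mulrDl !mulrDr.
rewrite -(exp_stable hk) ?leqW ?leq_maxl // -(exp_stable hl) ?leqW ?leq_maxr //.
by rewrite !(exprSr _ (maxn k l).+1) -!mulrA ay bx !mulr0 addr0 add0r.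
Qed.

Lemma is_drazin_inverseN {a x} :
  is_drazin_inverse a x -> is_drazin_inverse (- a) (- x).
Proof.
case=> xax ax [k hk]; split; rewrite ?mulrNN ?mulrN ?xax //.
by exists k; rewrite exprSr -mulrA mulrNN exprNn -mulrA (mulrA _ a) -exprSr -hk.
Qed.

Lemma is_drazin_inverse_split {c e f x y} :
    is_drazin_inverse (c * e) x -> is_drazin_inverse (c * f) y ->
    GRing.comm c e -> GRing.comm c f -> e * f = 0 -> f * e = 0 ->
  is_drazin_inverse (c * (e + f)) (x + y).
Proof.
move=> hx hy ce cf ef fe; rewrite mulrDr; apply: is_drazin_inverseD => //.
  by rewrite cf -mulrA (mulrA e) ef mul0r mulr0.
by rewrite ce -mulrA (mulrA f) fe mul0r mulr0.
Qed.

Lemma idem_comm_mul {e f} :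
  GRing.comm e f -> e * e = e -> f * f = f -> e * f * (e * f) = e * f.
Proof.
by move=> ef ee ff; rewrite mulrA -(mulrA e f) -ef mulrA ee -mulrA ff.
Qed.

Lemma mulr_comm_eq0 {x y z t} :
  GRing.comm y z -> y * t = 0 -> x * y * (z * t) = 0.
Proof. by move=> yz yt; rewrite -mulrA (mulrA y) yz -(mulrA z) yt !mulr0. Qed.

Lemma is_drazin_inverse_corner {c e x} :
    is_drazin_inverse c x -> GRing.comm e c -> GRing.comm e x -> e * e = e ->
  is_drazin_inverse (c * e) (x * e).
Proof.
move=> [xcx cx [k hk]] ec ex ee.
have ecx : GRing.comm e (c * x) by apply: commrM.
have cexe y z : GRing.comm e z -> y * e * (z * e) = y * z * e.
  by move=> ez; rewrite -mulrA (mulrA e) ez -(mulrA z) ee mulrA.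
split; first by rewrite !cexe // xcx.
  by rewrite !cexe // cx.
have /commr_sym ce := ec.
(* A positive exponent is needed for the power of [e] to be [e] and not 1. *)
exists k.+1; rewrite !exprMn_comm // !(@idem_expS e) // cexe //.
by rewrite -(exp_stable hk (leqnSn k)).
Qed.

(** Jacobson's lemma: formally, if [u] is the geometric series of [x * y], then [1 + y * u * x] is
    that of [y * x]. *)
Lemma is_inverse_1B_swap {x y u} :
  is_inverse (1 - x * y) u -> is_inverse (1 - y * x) (1 + y * u * x).
Proof.
move=> [xu ux]; split.
  rewrite mulrDr mulr1 -!mulrA (mulrA y) mulrBl mul1r -!mulrA.
  have -> : y * (u * x) - y * (x * (y * (u * x))) = y * (((1 - x * y) * u) * x).
    by rewrite mulrBl mul1r mulrBl mulrBr !mulrA.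
  by rewrite xu mul1r subrK.
rewrite mulrDl mul1r.
have -> : y * u * x * (1 - y * x) = y * (u * (1 - x * y)) * x.
  by rewrite !mulrBr !mulr1 mulrBl !mulrA.
by rewrite ux mulr1 subrK.
Qed.

End RingDrazin.

(** * Elements that commute up to a scalar *)

Section QuasiCommute.
Set Implicit Arguments.
Unset Strict Implicit.
Variables (F : fieldType) (A : pzAlgType F).
Implicit Types (l : F) (a b x y : A).

Lemma alg_scale0r l : alg_scale l (0 : A) = 0.
Proof. by rewrite -[X in alg_scale l X](mulr0 (0 : A)) alg_scaleAl mulr0. Qed.

Definition qcomm l x y := x * y = alg_scale l (y * x).

Lemma qcomm1 x y : GRing.comm x y -> qcomm 1 x y.
Proof. by move=> h; rewrite /qcomm alg_scale1. Qed.

Lemma qcomm_sym {l x y} : l != 0 -> qcomm l x y -> qcomm l^-1 y x.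
Proof. by move=> l0 h; rewrite /qcomm h alg_scaleA mulVf // alg_scale1. Qed.

Lemma qcommXl {l x y} n : qcomm l x y -> qcomm (l ^+ n) (x ^+ n) y.
Proof.
move=> h; elim: n => [|n IHn]; first by rewrite /qcomm mulr1 mul1r alg_scale1.
by rewrite /qcomm (exprSr x) -mulrA h -alg_scaleAr (mulrA _ y) IHn
           -alg_scaleAl alg_scaleA mulrA exprS.
Qed.

Lemma qcommXr {l x y} n : qcomm l x y -> qcomm (l ^+ n) x (y ^+ n).
Proof.
move=> h; elim: n => [|n IHn]; first by rewrite /qcomm mulr1 mul1r alg_scale1.
by rewrite /qcomm (exprS y) mulrA h -alg_scaleAl -(mulrA y x) IHn
           -alg_scaleAr alg_scaleA mulrA exprS.
Qed.

Lemma qcommMl {l x y e} : qcomm l x y -> GRing.comm e y -> qcomm l (x * e) y.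
Proof. by move=> h ey; rewrite /qcomm -mulrA ey mulrA h -alg_scaleAl mulrA. Qed.

(** Both off-diagonal Peirce components of [b] with respect to [p] vanish: write [p] with a factor
    [a ^+ n.+1], carry this power across [b] at the price of a scalar, and let it meet [1 - p],
    which it annihilates. *)
Lemma qcomm_drazin_idem {l a b aD} : l != 0 -> is_drazin_inverse a aD ->
  qcomm l a b -> GRing.comm b (a * aD).
Proof.
move=> l0 ha ab; have [n hn] := drazin_nilp ha.
have pX := drazin_idemX n ha; set p := a * aD in pX *.
have api0 : a ^+ n.+1 * (1 - p) = 0 by [].
have pia0 : (1 - p) * a ^+ n.+1 = 0.
  rewrite -api0; apply/commrX/commr_sym/commrB; first exact: commr1.
  exact: drazin_comm_idem.
have pX' : p = aD ^+ n.+1 * a ^+ n.+1.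
  by rewrite pX; apply/commrX/commr_sym/commrX/commr_sym/drazin_comm.
have bpl : (1 - p) * b * p = 0.
  rewrite {2}pX -mulrA (mulrA b) (qcomm_sym _ (qcommXl n.+1 ab)) ?expf_neq0 //.
  by rewrite -alg_scaleAl -alg_scaleAr !mulrA pia0 !mul0r alg_scale0r.
have bpr : p * b * (1 - p) = 0.
  rewrite {1}pX' -!mulrA (mulrA (a ^+ _)) (qcommXl n.+1 ab).
  by rewrite -alg_scaleAl -alg_scaleAr -!mulrA api0 !mulr0 alg_scale0r.
rewrite /GRing.comm -/p; have /eqP := bpl.
rewrite mulrBl mul1r mulrBl subr_eq0 => /eqP ->.
by have /eqP := bpr; rewrite mulrBr mulr1 subr_eq0 => /eqP.
Qed.

(** Writing [aD] as [aD * (a * aD)] and moving the idempotent across [b] brings [b * a] between two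
    copies of [aD], where the relation applies. *)
Lemma qcomm_drazin {l a b aD} : l != 0 -> is_drazin_inverse a aD ->
  qcomm l a b -> qcomm l^-1 aD b.
Proof.
move=> l0 ha ab; have bp := qcomm_drazin_idem l0 ha ab.
rewrite /qcomm -{1}(drazin_mulr ha) -mulrA -bp !mulrA -(mulrA aD).
rewrite (qcomm_sym l0 ab) -alg_scaleAr -alg_scaleAl !mulrA -(drazin_comm ha).
by rewrite -bp -[b * _ * aD]mulrA (drazin_mull ha).
Qed.

Lemma comm_drazin {a e aD} : is_drazin_inverse a aD ->
  GRing.comm e a -> GRing.comm e aD.
Proof.
move=> ha ea; have := qcomm_drazin (oner_neq0 F) ha (qcomm1 (commr_sym ea)).
by rewrite /qcomm invr1 alg_scale1 => /esym.
Qed.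

(** Reordering the factors makes [(x * y) ^+ n] a scalar multiple of [x ^+ n * y ^+ n]. *)
Lemma qcomm_nilpM {l x y n} :
  l != 0 -> qcomm l x y -> x ^+ n = 0 -> (x * y) ^+ n = 0.
Proof.
move=> l0 xy; suff [k ->] : exists k, (x * y) ^+ n = alg_scale k (x ^+ n * y ^+ n).
  by move=> ->; rewrite mul0r alg_scale0r.
elim: n => [|n [k IHn]]; first by exists 1; rewrite alg_scale1 mulr1.
exists (k * l^-1 ^+ n); rewrite exprS IHn -alg_scaleAr -alg_scaleA; congr alg_scale.
rewrite -mulrA (mulrA y) (qcommXr n (qcomm_sym l0 xy)).
by rewrite -alg_scaleAl -alg_scaleAr !exprS !mulrA.
Qed.

Lemma qcomm_nilpD {l x y n m} : l != 0 -> qcomm l x y ->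
  x ^+ n = 0 -> y ^+ m = 0 -> (x + y) ^+ (n + m) = 0.
Proof.
move=> l0 xy xn ym.
(* This form of the claim goes by induction on k without a q-binomial formula. *)
suff h k i j : (n + m <= i + j + k)%N -> x ^+ i * y ^+ j * (x + y) ^+ k = 0.
  by rewrite -(h (n + m)%N 0%N 0%N) ?add0n // mulr1 mul1r.
(* Each step absorbs one factor [x + y]: its [y] raises [j], its [x] crosses [y ^+ j] up to a scalar
   and raises [i]. With none left, [n <= i] or [m <= j]. *)
elim: k i j => [|k IHk] i j hk.
  rewrite addn0 in hk; rewrite mulr1.
  have [/subnK <-|ni] := leqP n i; first by rewrite exprD xn mulr0 mul0r.
  have /subnKC <- : (m <= j)%N.
    by rewrite -(leq_add2l n); apply: leq_trans hk _; rewrite leq_add2r ltnW.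
  by rewrite exprD ym mul0r mulr0.
rewrite exprS mulrA mulrDr mulrDl -[_ * y]mulrA -exprSr.
rewrite IHk ?addr0; last by rewrite addnS addSnnS.
rewrite -[_ * x]mulrA (qcommXl j (qcomm_sym l0 xy)) -alg_scaleAr -alg_scaleAl.
by rewrite mulrA -exprSr IHk ?alg_scale0r // !addSn -addnS.
Qed.

End QuasiCommute.

(** * The corners on which one element is invertible and the other nilpotent *)

Section Corners.
Variables (F : fieldType) (A : pzAlgType F).
Set Implicit Arguments.
Unset Strict Implicit.
Implicit Types (l : F) (a b aD bD u : A).

Lemma qcomm_comm_spectral {l a b aD bD} : l != 0 ->
  is_drazin_inverse a aD -> is_drazin_inverse b bD -> qcomm l a b ->
  [/\ GRing.comm (a * aD) b, GRing.comm (a * aD) (spectral_idem b bD),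
      GRing.comm (spectral_idem b bD) a & GRing.comm (spectral_idem b bD) aD].
Proof.
move=> l0 ha hb ab; have l'0 : l^-1 != 0 by rewrite invr_eq0.
have pb : GRing.comm (a * aD) b by apply/commr_sym/(qcomm_drazin_idem l0 ha ab).
have qa := qcomm_drazin_idem l'0 hb (qcomm_sym l0 ab).
have ra : GRing.comm (spectral_idem b bD) a.
  exact/commr_sym/comm_spectral_idem.
split=> //; last exact: comm_drazin ha ra.
by apply: comm_spectral_idem; apply: commrM => //; apply: comm_drazin hb pb.
Qed.

Lemma spectral_part_nilp {a e aD} : is_drazin_inverse a aD -> GRing.comm e a ->
    e * e = e -> spectral_idem a aD * e = e ->
  exists n, (a * e) ^+ n = 0.
Proof.
move=> ha ea ee re; have [n hn] := drazin_nilp ha; exists n.+1.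
rewrite exprMn_comm; last exact: commr_sym.
by rewrite (idem_expS _ ee) -re mulrA hn mul0r.
Qed.

(** [b * spectral_idem b bD] is nilpotent and commutes with [aD] up to a scalar, so the subtracted
    product is nilpotent. *)
Lemma corner_unit {l a b aD bD} : l != 0 ->
    is_drazin_inverse a aD -> is_drazin_inverse b bD -> qcomm l a b ->
  exists u, is_inverse (1 - b * spectral_idem b bD * aD) u.
Proof.
move=> l0 ha hb ab; have [_ _ _ raD] := qcomm_comm_spectral l0 ha hb ab.
have l'0 : l^-1 != 0 by rewrite invr_eq0.
have bq := drazin_comm_idem hb.
have rr := spectral_idem_idem hb.
have [n hn] := spectral_part_nilp hb (commr_sym (comm_spectral_idem bq)) rr rr.
have baD := qcomm_sym l'0 (qcomm_drazin l0 ha ab).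
apply: (@is_inverse_1B_nilp _ _ n); apply: qcomm_nilpM (qcommMl baD raD) hn.
by rewrite invr_eq0.
Qed.

(** In the corner with unit [a * aD * spectral_idem b bD], [a] has inverse [aD], and [a - b] is
    [1 - b * aD] times [a]; the two elements are mutually inverse there, and [corner_is_drazin]
    applies. *)
Lemma corner_drazin {l a b aD bD u} : l != 0 ->
    is_drazin_inverse a aD -> is_drazin_inverse b bD -> qcomm l a b ->
    is_inverse (1 - b * spectral_idem b bD * aD) u ->
  is_drazin_inverse ((a - b) * (a * aD * spectral_idem b bD))
                    (aD * u * spectral_idem b bD).
Proof.
move=> l0 ha hb ab hu; have [pb pr ra raD] := qcomm_comm_spectral l0 ha hb ab.
have aaD := drazin_comm ha; have rr := spectral_idem_idem hb.
have paDE := drazin_mull ha; have pp := drazin_idem ha.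
have rb : GRing.comm (spectral_idem b bD) b.
  exact/commr_sym/comm_spectral_idem/drazin_comm_idem.
move: (spectral_idem b bD) => r in pr ra raD rr rb hu *.
set p := a * aD in pb pr paDE pp *.
have rz : GRing.comm r (1 - b * r * aD).
  by apply: commrB; [apply: commr1 | do ![apply: commrM => //]].
have ru := is_inverse_comm hu rz.
have rp := commr_sym pr; have [zu uz] := hu.
(* [K1] and [K2] bring out the factor that [u] inverts, [K1] for the product with [a - b] on the
   left, [K2] for the one with [a - b] on the right. *)
have K1 : (a - b) * aD * r = p * (1 - b * r * aD) * r.
  rewrite mulrBr mulr1 !mulrBl -/p; congr (_ - _).
  by rewrite -(mulrA b r) raD !mulrA pb -(mulrA b p) paDE -(mulrA _ r r) rr.
have K2 : (a - b) * p * r = (1 - b * r * aD) * a * p * r.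
  rewrite !(mulrBl, mul1r); congr (_ - _).
  rewrite -(mulrA _ aD a) -aaD -/p -(mulrA _ p p) pp -(mulrA b r) rp.
  by rewrite mulrA -(mulrA _ r r) rr.
have E1 : p * r * aD = aD * r by rewrite -mulrA raD mulrA paDE.
have ur : u * r = r * u by rewrite ru.
have E4 : p * r * (aD * u * r) = aD * u * r.
  by rewrite !mulrA E1 -(mulrA aD r) ru mulrA -(mulrA _ r r) rr.
have rX : GRing.comm r ((1 - b * r * aD) * a * p) by do ![apply: commrM => //].
apply: (@corner_is_drazin _ _ _ (p * r)) => //.
- rewrite -[(a - b) * _ * _]mulrA E4 -(mulrA aD) ur !mulrA K1 -(mulrA _ r u) ru mulrA.
  by rewrite -(mulrA p) zu mulr1.
- rewrite (mulrA (a - b)) K2 -(mulrA _ r) (mulrA r) rX -(mulrA _ r r) rr.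
  by rewrite !mulrA -(mulrA aD u) uz mulr1 -aaD -/p -(mulrA p a) -/p pp.
- rewrite -[LHS]mulrA; congr (_ * _).
  by rewrite -mulrA (mulrA r) rp -(mulrA p r) rr mulrA pp.
Qed.

End Corners.

(** * Assembly of the four corners *)

Theorem theorem2p3 (F : fieldType) (A : pzAlgType F) (a b aD bD : A)
    (lambda : F)
    (haD : is_drazin_inverse a aD) (hbD : is_drazin_inverse b bD)
    (hlambda : lambda != 0) (hab : a * b = alg_scale lambda (b * a)) :
  let api := spectral_idem a aD in
  let bpi := spectral_idem b bD in
  let w := a * aD * (a - b) * b * bD in
  (drazin_invertible (a - b) <-> drazin_invertible w) /\
  (forall abD wD : A,
     is_drazin_inverse (a - b) abD -> is_drazin_inverse w wD ->
     exists u v : A,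
       [/\ is_inverse (1 - b * bpi * aD) u,
           is_inverse (1 - bD * a * api) v
         & abD = wD + aD * u * bpi - api * v * bD]).
Proof.
move=> api bpi w.
have l'0 : lambda^-1 != 0 by rewrite invr_eq0.
have hba := qcomm_sym hlambda hab.
have [pb pr ra raD] := qcomm_comm_spectral hlambda haD hbD hab.
have [qa qs sb sbD] := qcomm_comm_spectral l'0 hbD haD hba.
have [u hu] := corner_unit hlambda haD hbD hab.
(* Exchanging a and b gives the corner (1-p)q, with $(1-aa^{\pi}b^D)^{-1}$
   instead of the $(1-b^Daa^{\pi})^{-1}$ of the theorem; is_inverse_1B_swap
   passes from one to the other. *)
have [u' hu'] := corner_unit l'0 hbD haD hba.
have h1 := corner_drazin hlambda haD hbD hab hu.
have h2 := corner_drazin l'0 hbD haD hba hu'.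
pose p := a * aD; pose q := b * bD.
have pp : p * p = p := drazin_idem haD.
have qq : q * q = q := drazin_idem hbD.
have pi0 : p * api = 0 := idem_spectral_idem haD.
have ip : api * p = 0 := spectral_idem_idem0 haD.
have qi : q * bpi = 0 := idem_spectral_idem hbD.
have iq : bpi * q = 0 := spectral_idem_idem0 hbD.
have pDapi : p + api = 1 by rewrite addrC subrK.
have qDbpi : q + bpi = 1 by rewrite addrC subrK.
have pq : GRing.comm p q.
  by apply: commrM => //; apply: comm_drazin hbD pb.
have cp : GRing.comm (a - b) p.
  by apply/commr_sym/commrB => //; apply/commr_sym/drazin_comm_idem.
have cq : GRing.comm (a - b) q.
  by apply/commr_sym/commrB => //; apply/commr_sym/drazin_comm_idem.
have capi : GRing.comm (a - b) api by apply: comm_spectral_idem.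
have cbpi : GRing.comm (a - b) bpi by apply: comm_spectral_idem.
have apiq : GRing.comm q api by apply/comm_spectral_idem/commr_sym.
have apibpi : GRing.comm api bpi by apply/comm_spectral_idem/commr_sym.
have wE : w = (a - b) * (p * q).
  by rewrite /w -(mulrA _ b) -/p -/q -cp mulrA.
(* [h2] concerns [b - a]; the change of sign produces the minus sign of the third term of the
   formula. *)
have h2N := is_drazin_inverseN h2.
rewrite -mulNr opprB -/p -/q -/api -/bpi in h1 h2N.
have h4 : is_drazin_inverse ((a - b) * (api * bpi)) 0.
  set e := api * bpi.
  have ee : e * e = e.
    by apply: idem_comm_mul => //; apply: spectral_idem_idem.
  have ea : GRing.comm e a.
    apply/commr_sym/commrM; last exact: commr_sym.
    exact/comm_spectral_idem/drazin_comm_idem.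
  have eb : GRing.comm e b.
    apply/commr_sym/commrM; first exact: commr_sym.
    exact/comm_spectral_idem/drazin_comm_idem.
  have ae : api * e = e by rewrite mulrA (spectral_idem_idem haD).
  have be : bpi * e = e by rewrite /e apibpi mulrA (spectral_idem_idem hbD).
  have [n hn] := spectral_part_nilp haD ea ee ae.
  have [m hm] := spectral_part_nilp hbD eb ee be.
  (* The sign goes to [e], so that the compression of [a - b] is a sum, as [qcomm_nilpD] requires.
     As [qcommMl] acts on the left argument only, [q1] and [q2] swap the arguments in between. *)
  have hm' : (b * - e) ^+ m = 0 by rewrite mulrN exprNn hm mulr0.
  have q1 := qcomm_sym hlambda (qcommMl hab eb).
  have eae : GRing.comm (- e) (a * e).
    by apply/commr_sym/commrN/commr_sym/commrM.
  have q2 := qcomm_sym l'0 (qcommMl q1 eae); rewrite invrK in q2.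
  rewrite mulrBl -mulrN.
  exact: nilp_is_drazin (qcomm_nilpD hlambda q2 hn hm').
(* The splitting has two levels: [p] and [api] are each cut along [q + bpi = 1], then 1 is cut as
   [p + api]. The summand 0 in [hapi] is the Drazin inverse on the nilpotent corner. *)
have drazin_of_w wD : is_drazin_inverse w wD ->
    is_drazin_inverse (a - b) (wD + aD * u * bpi - bD * u' * api).
  rewrite wE => hw.
  have hp : is_drazin_inverse ((a - b) * p) (wD + aD * u * bpi).
    have -> : p = p * q + p * bpi by rewrite -mulrDr qDbpi mulr1.
    apply: is_drazin_inverse_split => //; try exact: commrM.
      exact: mulr_comm_eq0 (commr_sym pq) qi.
    exact: mulr_comm_eq0 (commr_sym pr) iq.
  have hapi : is_drazin_inverse ((a - b) * api) (- (bD * u' * api) + 0).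
    have {1}-> : api = api * q + api * bpi by rewrite -mulrDr qDbpi mulr1.
    apply: is_drazin_inverse_split => //; try exact: commrM.
    - by rewrite -apiq.
    - exact: mulr_comm_eq0 apiq qi.
    - exact: mulr_comm_eq0 (commr_sym apibpi) iq.
  rewrite -[a - b]mulr1 -pDapi -[- (_ * api)]addr0.
  exact: is_drazin_inverse_split.
split; first split.
(* [w] is the compression of [a - b] to an idempotent commuting with [a - b], hence with [x]. *)
- move=> [x hx]; exists (x * (p * q)); rewrite wE.
  have epq : GRing.comm (p * q) (a - b) by apply/commr_sym/commrM.
  apply: is_drazin_inverse_corner => //; first exact: comm_drazin hx epq.
  exact: idem_comm_mul.
- by move=> [wD hw]; eexists; apply: drazin_of_w hw.
move=> x wD hx hw; have [_ u'z] := hu'.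
have hv := is_inverse_1B_swap hu'; rewrite mulrA in hv.
exists u, (1 + bD * u' * (a * api)); split=> //.
rewrite (is_drazin_inverse_uniq hx (drazin_of_w _ hw)); congr (_ - _).
(* This resolvent identity gives [v * bD = bD * u'] for the chosen [v]; moving [api] to the far
   right then matches the third term. *)
have u'E : 1 + u' * (a * api * bD) = u'.
  by rewrite -{1}u'z mulrBr mulr1 subrK.
have vbD : (1 + bD * u' * (a * api)) * bD = bD * u'.
  by rewrite mulrDl mul1r -!mulrA -[X in X + _]mulr1 -mulrDr !mulrA
             -(mulrA u') -(mulrA u') u'E.
have apia : GRing.comm api a.
  exact/commr_sym/comm_spectral_idem/drazin_comm_idem.
have apiu' : GRing.comm api u'.
  apply: (is_inverse_comm hu'); apply: commrB; first exact: commr1.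
  by do ![apply: commrM => //].
by rewrite -[RHS]mulrA vbD mulrA sbD -[RHS]mulrA apiu' mulrA.
Qed.
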